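(* Let $f:\mathbb{R}^d\to\mathbb{R}$ be differentiable, $L$-smooth ($L>0$) and $\mu$-strongly convex ($\mu>0$), with unique minimizer $\theta^*$. Let $\mathcal{D}$ be a probability distribution on $\mathbb{R}^d$ such that (i) $\mathbb{E}_{s\sim\mathcal{D}}[\|s\|_2^2]<\infty$; (ii) there is a constant $\mu_{\mathcal{D}}>0$ with $\mathbb{E}_{s\sim\mathcal{D}}|\langle v,s\rangle|\ge\mu_{\mathcal{D}}\|v\|_2$ for all $v\in\mathbb{R}^d$; (iii) $\mathbb{P}_{s\sim\mathcal{D}}(\|s\|_2\le1)=1$; (iv) $\mu_{\mathcal{D}}<1$. Let $h\in\left(\frac{1}{\sqrt{1-\frac{\mu_{\mathcal{D}}^2\mu}{L}}},\infty\right)$ and let $\{\theta^t\}_{t\ge1}$ be generated by the Stochastic Three Points (STP) algorithm with step sizes $\alpha_t=\frac{|f(\theta^t+h^{-t}s_t)-f(\theta^t)|}{Lh^{-t}}$. Then for every $s\in(0,1)$, as $T\to\infty$, $$f(\theta^T)-f(\theta^* )=o\left(\left(1-s\,\frac{\mu_{\mathcal{D}}^2\mu}{L}\right)^T\right)\quad\text{almost surely.}$$ In particular, if $\mu_{\mathcal{D}}=\frac{K}{\sqrt d}$ for some constant $K>0$, then for every $s\in(0,1)$, $f(\theta^T)-f(\theta^* )=o\left(\left(1-s\,\frac{\mu K^2}{dL}\right)^T\right)$ almost surely.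
   Context: $L$-smooth means $\|\nabla f(x)-\nabla f(y)\|_2\le L\|x-y\|_2$ for all $x,y\in\mathbb{R}^d$. $\mu$-strongly convex means $f(y)\ge f(x)+\langle\nabla f(x),y-x\rangle+\frac\mu2\|y-x\|_2^2$ for all $x,y\in\mathbb{R}^d$. STP algorithm: given a deterministic initial point $\theta^1\in\mathbb{R}^d$ and the distribution $\mathcal{D}$, for $t=1,2,\ldots$ draw a random vector $s_t\sim\mathcal{D}$ (the $s_t$ being independent), compute the step size $\alpha_t$ (which here depends on $\theta^t$ and $s_t$), and set $\theta^{t+1}\in\arg\min_{\theta\in\{\theta^t,\ \theta^t+\alpha_ts_t,\ \theta^t-\alpha_ts_t\}}f(\theta)$, with ties broken by a fixed measurable rule depending only on $(t,\theta^t,s_t)$. *)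

(* Defs.v *)
From HB Require Import structures.
From mathcomp Require Import all_boot all_order all_algebra.
From mathcomp Require Import finmap.
From mathcomp Require Import all_classical all_reals all_analysis.

Set Implicit Arguments.
Unset Strict Implicit.
Unset Printing Implicit Defensive.

Import Order.TTheory GRing.Theory Num.Theory.
Import numFieldNormedType.Exports.

Local Open Scope classical_set_scope.
Local Open Scope ring_scope.

(* The library has no sigma-algebra on matrices: R^d gets its Borel one. *)
HB.instance Definition _ (R : realType) (d : nat) :=
  Measurable.copy 'rV[R]_d (g_sigma_algebraType (@open 'rV[R]_d)).

Section euclidean.
Variables (R : realType) (d : nat).
Implicit Types (u v x y : 'rV[R]_d) (f : 'rV[R]_d -> R).

Definition dot u v : R := \sum_(i < d) u 0 i * v 0 i.

(* The library norm `|v| on row vectors is the max norm. *)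
Definition norm2 v : R := Num.sqrt (dot v v).

Definition grad f x : 'rV[R]_d := \row_(i < d) 'D_(delta_mx 0 i) f x.

Definition smooth (L : R) f :=
  forall x y, norm2 (grad f x - grad f y) <= L * norm2 (x - y).

Definition strongly_convex (mu : R) f :=
  forall x y, f y >= f x + dot (grad f x) (y - x) + mu / 2 * norm2 (y - x) ^+ 2.

Definition argmin (A : set 'rV[R]_d) f : set 'rV[R]_d :=
  [set x | A x /\ forall y, A y -> f x <= f y].

Definition unique_minimizer f x := argmin setT f = [set x].

End euclidean.

Section iid.
Context (dO : measure_display) (Omega : measurableType dO) (R : realType).
Context (P : probability Omega R).
Context (dT : measure_display) (T : measurableType dT).

Definition independent_RVs (I : set nat) (X : nat -> {RV P >-> T}) :=
  forall (J : {fset nat}) (B : nat -> set T),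
    [set` J] `<=` I -> (forall j, j \in J -> measurable (B j)) ->
    P (\bigcap_(j in [set` J]) X j @^-1` B j) =
    (\prod_(j <- J) P (X j @^-1` B j))%E.

Definition iid (I : set nat) (D : probability T R) (X : nat -> {RV P >-> T}) :=
  independent_RVs I X /\
  (forall i, I i -> forall B, measurable B -> distribution P (X i) B = D B).

End iid.

Section stp.
Context (R : realType) (d : nat).
Context (dO : measure_display) (Omega : measurableType dO).
Context (P : probability Omega R).

Definition stp_candidates (a : R) (x s : 'rV[R]_d) : set 'rV[R]_d :=
  [set x; x + a *: s; x - a *: s].

(* Time starts at t = 1: the values s 0 and theta 0 are irrelevant.
   rule t is the measurable tie-breaking selection: it maps (theta^t, s_t) to
   the chosen minimizer among the three candidates. *)
Definition is_STP (f : 'rV[R]_d -> R) (D : probability 'rV[R]_d R)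
    (alpha : nat -> 'rV[R]_d -> 'rV[R]_d -> R) (theta1 : 'rV[R]_d)
    (rule : nat -> 'rV[R]_d * 'rV[R]_d -> 'rV[R]_d)
    (s : nat -> {RV P >-> 'rV[R]_d}) (theta : nat -> Omega -> 'rV[R]_d) :=
  [/\ iid [set t | (0 < t)%N] D s,
      forall t, (0 < t)%N ->
        measurable_fun setT (rule t) /\
        (forall x v, argmin (stp_candidates (alpha t x v) x v) f
                       (rule t (x, v))),
      forall w, theta 1%N w = theta1
    & forall t, (0 < t)%N ->
        forall w, theta t.+1 w = rule t (theta t w, s t w)].

Definition stp_step (f : 'rV[R]_d -> R) (L h : R) (t : nat)
    (x v : 'rV[R]_d) : R :=
  `|f (x + h ^- t *: v) - f x| / (L * h ^- t).

End stp.

(* Main.v *)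
(* One step from x along s with |s| <= 1 decreases f by at least
   <grad f x, s>^2 / (2 L), up to an error L h^(-2t) / 8 coming from the finite
   difference in the step size. As s_t is independent of theta^t, taking
   expectations and using E <g, s>^2 >= muD^2 |g|^2 and the Polyak-Lojasiewicz
   inequality |grad f|^2 >= 2 mu (f - f* ) gives
     a_(t+1) <= q a_t + (L / 8) h^(-2t),   q = 1 - muD^2 mu / L,
   for a_t = E (f(theta^t) - f* ). Since h^(-2) < q, a_t = O(q^t). Hence for r > q
   the series of the (f(theta^t) - f* ) / r^t has a finite expectation, so it
   converges almost surely and its terms tend to 0. *)
Require Import Defs.
From HB Require Import structures.
From mathcomp Require Import all_boot all_order all_algebra.
From mathcomp Require Import finmap ring lra.
From mathcomp Require Import all_classical all_reals all_analysis.
From mathcomp Require Import measurable_realfun.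

Set Implicit Arguments.
Unset Strict Implicit.
Unset Printing Implicit Defensive.

Import Order.TTheory GRing.Theory Num.Theory.
Import numFieldNormedType.Exports.

Local Open Scope classical_set_scope.
Local Open Scope ring_scope.

(** * Bilinearity of the Euclidean inner product *)

Section dot.
Context (R : realType) (d : nat).
Implicit Types (u v x y : 'rV[R]_d) (c : R).

Lemma dotC u v : dot u v = dot v u.
Proof. by apply: eq_bigr => i _; rewrite mulrC. Qed.

Lemma dotDl u v x : dot (u + v) x = dot u x + dot v x.
Proof. by rewrite -big_split; apply: eq_bigr => i _; rewrite mxE mulrDl. Qed.

Lemma dotZl c u v : dot (c *: u) v = c * dot u v.
Proof. by rewrite mulr_sumr; apply: eq_bigr => i _; rewrite mxE mulrA. Qed.

Lemma dotNl u v : dot (- u) v = - dot u v.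
Proof. by rewrite -scaleN1r dotZl mulN1r. Qed.

Lemma dotDr u v x : dot x (u + v) = dot x u + dot x v.
Proof. by rewrite dotC dotDl !(dotC x). Qed.

Lemma dotZr c u v : dot u (c *: v) = c * dot u v.
Proof. by rewrite dotC dotZl dotC. Qed.

Lemma dotNr u v : dot u (- v) = - dot u v.
Proof. by rewrite dotC dotNl dotC. Qed.

Definition dotE := (dotDl, dotDr, dotZl, dotZr, dotNl, dotNr).

Lemma dot_ge0 u : 0 <= dot u u.
Proof. by apply: sumr_ge0 => i _; rewrite -expr2 sqr_ge0. Qed.

Lemma norm2_ge0 u : 0 <= norm2 u.
Proof. exact: sqrtr_ge0. Qed.

Lemma norm2_sqr u : norm2 u ^+ 2 = dot u u.
Proof. by rewrite sqr_sqrtr ?dot_ge0. Qed.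

End dot.

(** * Deterministic inequalities for smooth, strongly convex functions, up to the descent of one STP
    step *)

Section smooth_strongly_convex.
Context (R : realType) (d : nat) (f : 'rV[R]_d -> R) (L mu : R).
Hypotheses (f_diff : forall x, differentiable f x) (L_gt0 : 0 < L).
Hypotheses (f_smooth : smooth L f) (mu_gt0 : 0 < mu).
Hypothesis f_convex : strongly_convex mu f.
Implicit Types (u v x y : 'rV[R]_d).

Lemma derive_dot_grad x u : 'D_u f x = dot (grad f x) u.
Proof.
rewrite deriveE// [in LHS](row_sum_delta u) linear_sum.
apply: eq_bigr => i _.
by rewrite linearZ /= mxE deriveE// mulrC.
Qed.

Lemma is_derive_line x u (t : R) :
  is_derive t 1 (fun t => f (x + t *: u)) (dot (grad f (x + t *: u)) u).
Proof.
rewrite -derive_dot_grad.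
have quotientE :
    (fun h : R => h^-1 *: (((fun t => f (x + t *: u)) \o shift t) (h *: 1)
                           - f (x + t *: u))) =
    (fun h : R => h^-1 *: ((f \o shift (x + t *: u)) (h *: u)
                           - f (x + t *: u))).
  by apply/funext => h; rewrite /= scalerDl addrCA [h *: 1]mulr1.
constructor.
  by rewrite /derivable quotientE; exact: diff_derivable.
by rewrite /derive quotientE.
Qed.

(** The mean value theorem is applied on [0, 1] to [f] along the segment minus its quadratic
    majorant: the derivative [dphi c] is nonpositive because the gradient varies by at most L c
    |u|. *)
Lemma smooth_upper_bound x u :
  f (x + u) - f x <= dot (grad f x) u + L / 2 * norm2 u ^+ 2.
Proof.
set N := norm2 u ^+ 2.
pose phi (t : R) :=
  f (x + t *: u) - (t * dot (grad f x) u + L / 2 * (t ^+ 2 * N)).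
pose dphi (t : R) :=
  dot (grad f (x + t *: u)) u - (dot (grad f x) u + L * t * N).
have dE (t : R) : is_derive t 1 phi (dphi t).
  apply: is_deriveB; first exact: is_derive_line.
  apply: is_derive_eq.
  by rewrite !scaler0 !add0r /GRing.scale/=; field.
have cphi : {within `[0, 1]%classic, continuous phi}.
  by apply: derivable_within_continuous => t _; have [] := dE t.
have [c /andP[/= c0 c1] phi01] := MVT ltr01 (fun t _ => dE t) cphi.
suff : dphi c <= 0.
  move: phi01; rewrite /phi !scale1r scale0r addr0 !mul1r !expr1n expr0n/=.
  by rewrite !mul0r !mulr0 subr0; lra.
have {}c0 : 0 < c by move: c0; rewrite bnd_simp.
pose g := grad f (x + c *: u) - grad f x.
have g_le : dot g g <= (L * c) ^+ 2 * N.
  rewrite -norm2_sqr.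
  have := f_smooth (x + c *: u) x; rewrite -/g [x + _]addrC addrK => gL.
  have -> : (L * c) ^+ 2 * N = (L * norm2 (c *: u)) ^+ 2.
    by rewrite !exprMn !norm2_sqr !dotE /N norm2_sqr; ring.
  by rewrite ler_sqr ?nnegrE ?norm2_ge0// mulr_ge0 ?norm2_ge0// ltW.
have dphiE : dphi c = dot g u - L * c * N.
  by rewrite /dphi /g !dotE; lra.
rewrite dphiE -(pmulr_rle0 _ (mulr_gt0 L_gt0 c0)); clearbody g.
(* AM-GM: [2 L c <g, u> <= |g|^2 + (L c)^2 |u|^2] *)
have := dot_ge0 (g - (L * c) *: u).
rewrite !dotE (dotC u g) => amgm.
by move: amgm g_le; rewrite /N norm2_sqr; lra.
Qed.

Lemma convex_lower_bound x u : dot (grad f x) u <= f (x + u) - f x.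
Proof.
have := f_convex x (x + u); rewrite [x + u - x]addrC addKr.
have : 0 <= mu / 2 * norm2 u ^+ 2.
  by rewrite mulr_ge0 ?sqr_ge0// divr_ge0// ltW.
lra.
Qed.

(** With g = grad f x and u = y - x, add |g + mu u|^2 >= 0 to 2 mu times the strong convexity
    inequality. *)
Lemma polyak_lojasiewicz x y :
  2 * mu * (f x - f y) <= dot (grad f x) (grad f x).
Proof.
have := f_convex x y; rewrite norm2_sqr.
set g := grad f x; set u := y - x; clearbody g u => fxy.
have := dot_ge0 (g + mu *: u); rewrite !dotE (dotC u g) => sq.
have : 0 <= mu * (f y - (f x + dot g u + mu / 2 * dot u u)).
  by rewrite mulr_ge0 ?subr_ge0// ltW.
lra.
Qed.

(** Along a unit vector from 0, the quadratic lower and upper bounds of [f] share their linear part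
    and have curvatures [mu] and [L]. This is what makes the contraction factor positive. *)
Lemma strong_convexity_le_smoothness : (0 < d)%N -> mu <= L.
Proof.
case: d f f_diff f_smooth f_convex smooth_upper_bound => // n g _ _ gc gs _.
pose u : 'rV[R]_n.+1 := delta_mx 0 0.
have u1 : norm2 u ^+ 2 = 1.
  rewrite norm2_sqr /dot (bigD1 0)//= big1 => [|i /negPf i0].
    by rewrite !mxE/= mulr1 addr0.
  by rewrite !mxE i0 andbF mulr0.
have := gc 0 (0 + u); have := gs 0 u.
by rewrite !add0r subr0 u1; lra.
Qed.

(** With p = <grad f x, s>, the bound - c |p| + L c^2 / 2 on the change of [f] is least at c = |p| /
    L, with value - p^2 / (2 L). The actual step [a] is within eps / 2 of this c, which costs at
    most (L / 2) (eps / 2)^2. *)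
Lemma stp_step_descent (eps a fm : R) x s :
  0 < eps -> norm2 s <= 1 -> a = `|f (x + eps *: s) - f x| / (L * eps) ->
  fm <= f (x + a *: s) -> fm <= f (x - a *: s) ->
  fm + dot (grad f x) s ^+ 2 / (2 * L) <= f x + L / 8 * eps ^+ 2.
Proof.
move=> eps0 s1 aE fm1 fm2.
have N1 : norm2 s ^+ 2 <= 1 by rewrite expr_le1// norm2_ge0.
have N0 : 0 <= norm2 s ^+ 2 by rewrite sqr_ge0.
set N := norm2 s ^+ 2 in N1 N0; set p := dot (grad f x) s.
have up (c : R) : f (x + c *: s) - f x <= c * p + L / 2 * c ^+ 2.
  apply: le_trans (smooth_upper_bound _ _) _.
  have -> : norm2 (c *: s) ^+ 2 = c ^+ 2 * N.
    by rewrite /N !norm2_sqr !dotE; ring.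
  rewrite dotZr lerD2l ler_pM2l ?divr_gt0// -[leRHS]mulr1.
  by rewrite ler_wpM2l// sqr_ge0.
have lo := convex_lower_bound x (eps *: s); rewrite dotZr -/p in lo.
have dL : 0 < L * eps by rewrite mulr_gt0.
(* Convexity and smoothness place f (x + eps s) - f x between eps p and eps p + L eps^2 / 2;
   dividing by L eps leaves an error of eps / 2. *)
have ap : `|a - `|p| / L| <= eps / 2.
  have -> : a - `|p| / L = (`|f (x + eps *: s) - f x| - `|eps * p|) / (L * eps).
    rewrite aE normrM (gtr0_norm eps0); field.
    by rewrite !gt_eqF.
  rewrite normrM normfV (gtr0_norm dL) ler_pdivrMr//.
  apply: le_trans (ler_dist_dist _ _) _.
  have -> : eps / 2 * (L * eps) = L / 2 * eps ^+ 2 by field.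
  by rewrite ger0_norm ?subr_ge0// lerBlDl.
(* The sign of [p] decides which of the two trial points is the descent direction. *)
have fm_p : fm <= f x - a * `|p| + L / 2 * a ^+ 2.
  have [p0|p0] := ger0P p.
    by move: (up (- a)); rewrite scaleNr sqrrN; lra.
  by move: (up a); lra.
have e2 : (a - `|p| / L) ^+ 2 <= eps ^+ 2 / 4.
  have -> : eps ^+ 2 / 4 = (eps / 2) ^+ 2 by field.
  rewrite -(real_normK (num_real (_ - _))) ler_sqr ?nnegrE//.
  by rewrite divr_ge0// ltW.
have : L / 2 * (a - `|p| / L) ^+ 2 <= L / 2 * (eps ^+ 2 / 4).
  by rewrite ler_pM2l// divr_gt0.
have -> : L / 2 * (a - `|p| / L) ^+ 2 =
          L / 2 * a ^+ 2 - a * `|p| + p ^+ 2 / (2 * L).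
  by rewrite -[in RHS](real_normK (num_real p)); field; rewrite gt_eqF.
by move: fm_p; lra.
Qed.

End smooth_strongly_convex.

(** * Borel measurability on R^d *)

Section borel.
Context (R : realType) (d : nat).

Lemma continuous_measurable_rV (g : 'rV[R]_d -> R) :
  continuous g -> measurable_fun setT g.
Proof.
move=> /continuousP cg.
apply: (measurability _ (RGenOpens.measurableE R)) => _ [_ [a [b ->]] <-].
rewrite setTI; apply: sub_sigma_algebra; apply: cg; exact: interval_open.
Qed.

Lemma measurable_coord (i : 'I_d) :
  measurable_fun setT (fun v : 'rV[R]_d => v 0 i).
Proof. by apply: continuous_measurable_rV; exact: coord_continuous. Qed.

Lemma measurable_dot d1 (T : measurableType d1) (g1 g2 : T -> 'rV[R]_d) :
  (forall i, measurable_fun setT (fun x => g1 x 0 i)) ->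
  (forall i, measurable_fun setT (fun x => g2 x 0 i)) ->
  measurable_fun setT (fun x => dot (g1 x) (g2 x)).
Proof.
by move=> m1 m2; apply: measurable_sum => i; exact: measurable_funM.
Qed.

Lemma measurable_ball2 : measurable [set v : 'rV[R]_d | norm2 v <= 1].
Proof.
have -> : [set v : 'rV[R]_d | norm2 v <= 1] =
          setT `&` (fun v => dot v v) @^-1` `]-oo, 1]%classic.
  apply/seteqP; split => v /=; rewrite in_itv/= -norm2_sqr.
    by move=> v1; split => //; rewrite expr_le1// norm2_ge0.
  by move=> [_]; rewrite expr_le1// norm2_ge0.
by apply: measurable_dot => // i; exact: measurable_coord.
Qed.

(** A partial derivative is the pointwise limit of the difference quotients with step 1 / (n + 1),
    which are continuous in x. *)
Lemma measurable_grad (f : 'rV[R]_d -> R) (i : 'I_d) :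
  (forall x, differentiable f x) ->
  measurable_fun setT (fun x => grad f x 0 i).
Proof.
move=> df; pose e : 'rV[R]_d := delta_mx 0 i.
have cf : continuous f by move=> x; exact: differentiable_continuous (df x).
apply: (@measurable_fun_cvg _ _ _ _
  (fun n x => n.+1%:R * (f (n.+1%:R^-1 *: e + x) - f x))) => [n|x _].
  apply: measurable_funM => //; apply: measurable_funB.
    apply: (@continuous_measurable_rV (fun x => f (n.+1%:R^-1 *: e + x))) => x.
    have shift_cts : {for x, continuous (fun x => n.+1%:R^-1 *: e + x)}.
      exact: (continuousD (@cst_continuous _ _ _ _) (@cvg_id _ _)).
    exact: (continuous_comp shift_cts (cf _)).
  exact: (continuous_measurable_rV cf).
rewrite mxE.
have de : derivable f x e by exact: diff_derivable.
(* The derivative is a limit over punctured neighbourhoods of 0, so the steps must also be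
   nonzero. *)
have harmonic_dnbhs : (fun n => n.+1%:R^-1 : R) @ \oo --> (0 : R)^'.
  move=> A A0.
  have hA : \forall n \near \oo, harmonic n != 0 :> R -> A (harmonic n).
    exact: (cvg_harmonic (A0 : nbhs 0 [set y : R | y != 0 -> A y])).
  apply: filterS hA => n; apply.
  by rewrite /harmonic invr_eq0 pnatr_eq0.
apply: cvg_trans (cvg_comp _ _ harmonic_dnbhs de).
by apply: near_eq_cvg; apply: nearW => n /=; rewrite invrK.
Qed.

End borel.

(** * Independence of the iterates from later draws, and integration over the next draw *)

Section independence.
Local Open Scope ereal_scope.
Context (R : realType) (dO : measure_display) (Omega : measurableType dO).
Context (P : probability Omega R).
Context (dX dS : measure_display) (X : measurableType dX) (S : measurableType dS).
Context (D : probability S R) (s_ : nat -> {RV P >-> S}).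
Context (rule : nat -> X * S -> X) (theta : nat -> Omega -> X) (theta1 : X).
Hypothesis s_iid : iid [set t | (0 < t)%N] D s_.
Hypothesis mrule : forall t, (0 < t)%N -> measurable_fun setT (rule t).
Hypothesis theta_1 : forall w, theta 1%N w = theta1.
Hypothesis theta_rec : forall t, (0 < t)%N ->
  forall w, theta t.+1 w = rule t (theta t w, s_ t w).

Lemma measurable_theta t : measurable_fun setT (theta t.+1).
Proof.
elim: t => [|t IH].
  by rewrite (_ : theta 1 = cst theta1)//; apply/funext => w; rewrite theta_1.
rewrite (_ : theta t.+2 = rule t.+1 \o (fun w => (theta t.+1 w, s_ t.+1 w))).
  apply: measurableT_comp; first exact: mrule.
  by apply: measurable_fun_pair.
by apply/funext => w; rewrite theta_rec.
Qed.

Let Theta t : {mfun Omega >-> X} := mfun_Sub (mem_set (measurable_theta t)).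

Let measurable_pair t :
  measurable_fun setT (fun w => (theta t.+1 w, s_ t.+1 w)).
Proof. by apply: measurable_fun_pair => //; exact: measurable_theta. Qed.

Let Pair t : {mfun Omega >-> (X * S)%type} :=
  mfun_Sub (mem_set (measurable_pair t)).

Definition noise_event (J : {fset nat}) (B : nat -> set S) :=
  \bigcap_(j in [set` J]) s_ j @^-1` B j.

(* Independence of theta^(t+1) from the whole future is what makes the induction
   on t go through: theta^(t+2) consumes s_(t+1) and stays independent of the
   remaining draws. *)
Definition future_independent t := forall (J : {fset nat}) (B : nat -> set S) A,
  (forall j, j \in J -> (t < j)%N) -> (forall j, j \in J -> measurable (B j)) ->
  measurable A ->
  P (theta t.+1 @^-1` A `&` noise_event J B) =
  P (theta t.+1 @^-1` A) * \prod_(j <- J) D (B j).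

Lemma measurable_noise_event (J : {fset nat}) (B : nat -> set S) :
  (forall j, j \in J -> measurable (B j)) -> measurable (noise_event J B).
Proof.
move=> mB; apply: fin_bigcap_measurable => // j Jj.
by apply: measurable_funPTI; exact: mB.
Qed.

Lemma probability_noise_event (J : {fset nat}) (B : nat -> set S) :
  (forall j, j \in J -> (0 < j)%N) -> (forall j, j \in J -> measurable (B j)) ->
  P (noise_event J B) = \prod_(j <- J) D (B j).
Proof.
move=> J0 mB; have [ind law] := s_iid; rewrite /noise_event ind//.
rewrite big_seq [RHS]big_seq; apply: eq_bigr => j Jj.
by rewrite -(law j (J0 _ Jj) _ (mB _ Jj)).
Qed.

(** This is future independence for the single index t + 1: on rectangles, the joint law of
    theta^(t+1) and s_(t+1) is a product. *)
Lemma pair_law t A B : future_independent t -> measurable A -> measurable B ->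
  P (Pair t @^-1` (A `*` B)) = P (theta t.+1 @^-1` A) * D B.
Proof.
move=> indt mA mB; have := indt [fset t.+1]%fset (fun=> B) A.
rewrite big_seq_fset1 => <- //; last by move=> j; rewrite in_fset1 => /eqP ->.
congr (P _); apply/seteqP; split => w [/= Aw Bw]; split => //.
  by move=> j /=; rewrite in_fset1 => /eqP ->.
by apply: (Bw t.+1); rewrite /= in_fset1.
Qed.

(* Both sides are measures in C that agree on rectangles. *)
Lemma future_independent_pair t (J : {fset nat}) (B : nat -> set S)
    (C : set (X * S)) : future_independent t ->
  (forall j, j \in J -> (t.+1 < j)%N) ->
  (forall j, j \in J -> measurable (B j)) ->
  measurable C ->
  P (Pair t @^-1` C `&` noise_event J B) =
  P (Pair t @^-1` C) * P (noise_event J B).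
Proof.
move=> indt Jt mB mC; set E := noise_event J B.
have mE : measurable E by exact: measurable_noise_event.
have PE : P E \is a fin_num by exact: fin_num_measure.
(* The mass of [E] is recast as a nonnegative real, the type of factor that [mscale] takes. *)
pose p : {nonneg R} := NngNum (fine_ge0 (measure_ge0 P E)).
have pE : p%:num%:E = P E by rewrite /p/= fineK.
have PJ : P E = \prod_(j <- J) D (B j).
  apply: probability_noise_event => // j /Jt; exact: leq_trans.
have rect A B' : measurable A -> measurable B' ->
  P (Pair t @^-1` (A `*` B') `&` E) = P (theta t.+1 @^-1` A) * (P E * D B').
  move=> mA mB'.
  (* The constraint on s_(t+1) joins those on the later draws, so that future independence at t
     covers the whole event. *)
  pose J' := (t.+1 |` J)%fset.
  pose B'' j := if j == t.+1 then B' else B j.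
  have tJ : t.+1 \notin J by apply/negP => /Jt; rewrite ltnn.
  have -> : Pair t @^-1` (A `*` B') `&` E =
            theta t.+1 @^-1` A `&` noise_event J' B''.
    apply/seteqP; split => w.
      move=> [[/= Aw Bw] Ew]; split => // j /=; rewrite in_fset1U.
      move=> /orP[/eqP ->|Jj]; first by rewrite /B'' eqxx.
      rewrite /B''; case: eqP => [->//|_]; exact: Ew.
    move=> [Aw Ew]; split.
      split => //=; have := Ew t.+1; rewrite /B'' eqxx; apply.
      by rewrite /= in_fset1U eqxx.
    move=> j Jj; have := Ew j; rewrite /B''; case: eqP => [jt|_].
      by move: tJ; rewrite -jt => /negP; case/(_ Jj).
    by apply; rewrite /= in_fset1U (_ : j \in J) ?orbT.
  rewrite indt//; first last.
  - move=> j; rewrite in_fset1U /B'' => /orP[/eqP ->|Jj]; first by rewrite eqxx.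
    by case: eqP => // _; exact: mB.
  - by move=> j; rewrite in_fset1U => /orP[/eqP ->//|/Jt]; exact: ltnW.
  congr (_ * _); rewrite big_fsetU1//= /B'' eqxx muleC PJ; congr (_ * _).
  rewrite big_seq [RHS]big_seq; apply: eq_bigr => j Jj.
  by case: eqP => // jt; move: tJ; rewrite -jt Jj.
pose nuE := pushforward (mrestr P mE) (Pair t).
pose nu := mscale p (distribution P (Pair t)).
(* Both measures are identified with the product of the law of theta^(t+1) and P(E) D. *)
pose m2 := mscale p D.
have m2E B' : m2 B' = P E * D B' by rewrite /m2 /mscale /= pE.
have nuEE : (distribution P (Theta t) \x m2) C = nuE C.
  apply: product_measure_unique => // A B' mA mB'.
  by transitivity (P (Pair t @^-1` (A `*` B') `&` E)); rewrite // rect// -m2E.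
have nuC : (distribution P (Theta t) \x m2) C = nu C.
  apply: product_measure_unique => // A B' mA mB'.
  transitivity (p%:num%:E * P (Pair t @^-1` (A `*` B'))); first by [].
  by rewrite pE (pair_law indt)// muleCA -m2E.
by move: nuC; rewrite nuEE /nuE /nu /pushforward /mrestr /mscale /= pE muleC.
Qed.

Lemma future_independentP t : future_independent t.
Proof.
elim: t => [|t IH] J B A Jt mB mA.
  have -> : theta 1 = cst theta1 by apply/funext => w; rewrite theta_1.
  rewrite preimage_cst; case: ifPn => _.
    by rewrite setTI probability_setT mul1e probability_noise_event.
  by rewrite set0I measure0 mul0e.
(* The new iterate is a measurable function of the pair (theta^(t+1), s_(t+1)), which is independent
   of the draws after t + 1. *)
have -> : theta t.+2 @^-1` A = Pair t @^-1` (rule t.+1 @^-1` A).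
  by apply/funext => w; rewrite /preimage /= /mkset theta_rec//.
rewrite -probability_noise_event//; last by move=> j /Jt; exact: leq_trans.
apply: future_independent_pair => //.
by rewrite -[X in measurable X]setTI; exact: mrule.
Qed.

(** The joint law of the iterate and the next draw is the product of their laws, so Tonelli allows
    the draw to be integrated out first, with the iterate frozen. This replaces conditional
    expectation. *)
Lemma integral_next t (g : X * S -> \bar R) :
  measurable_fun setT g -> (forall z, 0 <= g z) ->
  \int[P]_w g (theta t.+1 w, s_ t.+1 w) =
  \int[P]_w \int[D]_v g (theta t.+1 w, v).
Proof.
move=> mg g0.
rewrite -(ge0_integral_distribution (Pair t) mg g0).
rewrite (@eq_measure_integral _ _ _ _ (distribution P (Theta t) \x D)); last first.
  move=> C mC _; apply/esym; apply: product_measure_unique => // A B mA mB.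
  exact: (pair_law (@future_independentP t) mA mB).
rewrite (fubini_tonelli1 g)//.
rewrite (ge0_integral_distribution (Theta t))//.
  exact: measurable_fun_fubini_tonelli_F.
by move=> x; exact: integral_ge0.
Qed.


End independence.

(** * Perturbed geometric recursions, and almost everywhere convergence from summable means *)

(** With M = c / (q - k), c k^t + M k^(t+1) = q M k^t, so a_t + M k^t shrinks by the factor q at
    each step. *)
Lemma perturbed_geometric_bound (R : realFieldType) (a : nat -> R) (q c k : R) :
  0 <= c -> 0 <= k -> k < q -> (forall t, a t.+1 <= q * a t + c * k ^+ t) ->
  forall t, a t <= (a 0%N + c / (q - k)) * q ^+ t.
Proof.
move=> c0 k0 kq rec t.
have qk : 0 < q - k by rewrite subr_gt0.
set M := c / (q - k).
have M0 : 0 <= M by rewrite divr_ge0// ltW.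
suff : a t + M * k ^+ t <= (a 0%N + M) * q ^+ t.
  by apply: le_trans; rewrite lerDl mulr_ge0// exprn_ge0.
elim: t => [|t IH]; first by rewrite !expr0 !mulr1.
have ME : c = M * (q - k) by rewrite /M divfK// gt_eqF.
rewrite [leRHS](_ : _ = q * ((a 0%N + M) * q ^+ t)); last by rewrite exprS; ring.
apply: (@le_trans _ _ (q * (a t + M * k ^+ t))).
  by apply: le_trans (lerD (rec t) (lexx _)) _; rewrite exprS {1}ME; lra.
by rewrite ler_wpM2l// ltW// (le_lt_trans k0).
Qed.

Lemma geometric_sum_le (R : realFieldType) (x : R) n :
  0 <= x -> x < 1 -> \sum_(0 <= i < n) x ^+ i <= (1 - x)^-1.
Proof.
move=> x0 x1; have x1' : 0 < 1 - x by rewrite subr_gt0.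
rewrite -[leRHS]mul1r ler_pdivlMr// mulrC big_mkord.
have -> : (1 - x) * \sum_(i < n) x ^+ i = 1 - x ^+ n.
  by rewrite -opprB mulNr -subrX1 opprB.
by rewrite gerBl exprn_ge0.
Qed.

Section ae_convergence.
Local Open Scope ereal_scope.
Context d (T : measurableType d) (R : realType).

(** Sum and integral commute for nonnegative terms, so the series of the [u n] has integral at most
    C / (1 - x). It is therefore finite almost everywhere, and there its terms tend to 0. *)
Lemma ae_cvg0_geometric (mu : {measure set T -> \bar R}) (u : nat -> T -> R)
    (C x : R) :
  (0 <= C)%R -> (0 <= x)%R -> (x < 1)%R ->
  (forall n, measurable_fun setT (u n)) -> (forall n w, (0 <= u n w)%R) ->
  (forall n, \int[mu]_w (u n w)%:E <= (C * x ^+ n)%:E) ->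
  {ae mu, forall w, (u ^~ w) @ \oo --> (0 : R)%R}.
Proof.
move=> C0 x0 x1 mu_ u0 ub.
have mE n : measurable_fun setT (fun w => (u n w)%:E).
  exact/measurable_EFinP.
pose S w := \sum_(n <oo) (u n w)%:E.
have S0 w : 0 <= S w by apply: nneseries_ge0 => n _ _; rewrite lee_fin.
have mS : measurable_fun setT S.
  by apply: ge0_emeasurable_sum => // n w _ _; rewrite lee_fin.
have intS : \int[mu]_w S w <= (C / (1 - x))%:E.
  rewrite /S integral_nneseries//; last by move=> n w _; rewrite lee_fin.
  have I0 n : 0 <= \int[mu]_w (u n w)%:E.
    by apply: integral_ge0 => w _; rewrite lee_fin.
  apply: lime_le; first by apply: is_cvg_nneseries => n _ _.
  apply: nearW => n; apply: (@le_trans _ _ (\sum_(0 <= i < n) (C * x ^+ i)%:E)).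
    by apply: lee_sum.
  by rewrite sumEFin lee_fin -mulr_sumr ler_wpM2l// geometric_sum_le.
have iS : mu.-integrable setT S.
  apply/integrableP; split => //.
  under eq_integral => w _ do rewrite gee0_abs//.
  by apply: le_lt_trans intS _; rewrite ltry.
apply: filterS (integrable_ae measurableT iS) => w /(_ I) Sw.
have : cvgn (series (u ^~ w)).
  apply: nondecreasing_is_cvgn.
    by apply: nondecreasing_series => n _ _; exact: u0.
  exists (fine (S w)) => _ [n _ <-]; rewrite -lee_fin fineK// /series/= -sumEFin.
  by apply: nneseries_lim_ge => k _ _; rewrite lee_fin.
exact: cvg_series_cvg_0.
Qed.

End ae_convergence.

(** * From the first absolute moment of <v, s> to its second moment *)

Section mean_square.
Local Open Scope ereal_scope.
Context (R : realType) (d : nat) (D : probability 'rV[R]_d R) (muD : R).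
Hypothesis muD_ge0 : (0 <= muD)%R.
Hypothesis D_dot : forall v : 'rV[R]_d,
    'E_D[fun s => `|dot v s|%R] >= (muD * norm2 v)%:E.

Lemma mean_square_dot (v : 'rV[R]_d) :
  (muD ^+ 2 * dot v v)%:E <= \int[D]_s (dot v s ^+ 2)%:E.
Proof.
set I := \int[D]_s _.
have mdot : measurable_fun setT (dot v).
  by apply: measurable_dot => // i; exact: measurable_coord.
have msq : measurable_fun setT (fun s => (dot v s ^+ 2)%:E).
  by apply/measurable_EFinP; exact: measurable_funX.
have mabs : measurable_fun setT (fun s => `|dot v s|%:E).
  by apply/measurable_EFinP; exact: measurableT_comp.
pose l : R := (muD * norm2 v)%R.
have l0 : (0 <= l)%R by rewrite mulr_ge0// norm2_ge0.
have lE : (muD ^+ 2 * dot v v = l ^+ 2)%R by rewrite exprMn norm2_sqr.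
(* [2 l |y| <= y^2 + l^2] replaces Jensen's inequality *)
have : (2 * l)%:E * l%:E <= I + (l ^+ 2)%:E.
  apply: (@le_trans _ _ ((2 * l)%:E * \int[D]_s `|dot v s|%:E)).
    apply: lee_wpmul2l; first by rewrite lee_fin mulr_ge0.
    have := D_dot v; rewrite expectation.unlock. exact.
  rewrite -ge0_integralZl//; last by rewrite lee_fin mulr_ge0.
  have -> : I + (l ^+ 2)%:E = \int[D]_s ((dot v s ^+ 2)%:E + (l ^+ 2)%:E).
    rewrite ge0_integralD//; last 2 first.
    - by move=> s _; rewrite lee_fin sqr_ge0.
    - by move=> s _; rewrite lee_fin sqr_ge0.
    by rewrite integral_cst// [X in _ * X]probability_setT mule1.
  apply: ge0_le_integral => //.
  - by move=> s _; rewrite -EFinM lee_fin; do 2?apply: mulr_ge0.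
  - exact: emeasurable_funM.
  - exact: emeasurable_funD.
  move=> s _; rewrite -EFinM -EFinD lee_fin.
  have := sqr_ge0 (`|dot v s| - l)%R; rewrite sqrrB real_normK ?num_real//.
  lra.
(* [I] is an extended real, so [l ^+ 2] is cancelled only in the finite case. *)
rewrite lE -EFinM; case: I => [r| |].
- by rewrite -EFinD !lee_fin; lra.
- by move=> _; exact: leey.
- by rewrite addNye.
Qed.
End mean_square.

(** * The STP process: pathwise descent, recursion for the mean gap, almost sure rate *)

Section stp_convergence.
Context (R : realType) (d : nat) (f : 'rV[R]_d -> R) (L mu : R).
Context (thetastar : 'rV[R]_d).
Hypotheses (f_diff : forall x, differentiable f x) (L_gt0 : 0 < L).
Hypotheses (f_smooth : smooth L f) (mu_gt0 : 0 < mu).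
Hypotheses (f_convex : strongly_convex mu f).
Hypothesis f_min : unique_minimizer f thetastar.
Context (D : probability 'rV[R]_d R) (muD : R).
Hypothesis muD_gt0 : 0 < muD.
Hypothesis D_dot : forall v : 'rV[R]_d,
    ('E_D[fun s => `|dot v s|%R] >= (muD * norm2 v)%:E)%E.
Hypothesis D_bounded : D [set s | norm2 s <= 1] = 1%E.
Context (h : R) (h_gt0 : 0 < h).
Context (dO : measure_display) (Omega : measurableType dO).
Context (P : probability Omega R).
Context (theta1 : 'rV[R]_d) (rule : nat -> 'rV[R]_d * 'rV[R]_d -> 'rV[R]_d).
Context (s_ : nat -> {RV P >-> 'rV[R]_d}) (theta : nat -> Omega -> 'rV[R]_d).
Hypothesis theta_STP : is_STP f D (stp_step f L h) theta1 rule s_ theta.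

(* The process starts at time 1, hence the shift. *)
Let gap t w : R := f (theta t.+1 w) - f thetastar.
Let slope t w : R := dot (grad f (theta t.+1 w)) (s_ t.+1 w).

Lemma minimizer_le x : f thetastar <= f x.
Proof.
have : argmin setT f thetastar by rewrite f_min.
by move=> [_]; apply.
Qed.

Lemma stp_gap_ge0 t w : 0 <= gap t w.
Proof. by rewrite subr_ge0 minimizer_le. Qed.

Lemma stp_argmin t w : argmin
  (stp_candidates (stp_step f L h t.+1 (theta t.+1 w) (s_ t.+1 w))
    (theta t.+1 w) (s_ t.+1 w)) f (theta t.+2 w).
Proof.
have [_ ruleP _ rec] := theta_STP; rewrite (rec t.+1)//.
exact: (ruleP t.+1 isT).2.
Qed.

Lemma stp_gap_nincr t w : gap t.+1 w <= gap t w.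
Proof.
rewrite lerD2r; have [_ amin] := stp_argmin t w.
by apply: amin; left; left.
Qed.

(** The gap never increases and starts from a deterministic value; this uniform bound makes the mean
    gaps finite. *)
Lemma stp_gap_le t w : gap t w <= f theta1 - f thetastar.
Proof.
elim: t => [|t IH]; last exact: le_trans (stp_gap_nincr t w) IH.
by have [_ _ t1 _] := theta_STP; rewrite /gap t1.
Qed.

Let mtheta t : measurable_fun setT (theta t.+1).
Proof.
have [_ ruleP t1 rec] := theta_STP.
exact: (measurable_theta (fun t t0 => (ruleP t t0).1) t1 rec).
Qed.

Lemma measurable_gap t : measurable_fun setT (gap t).
Proof.
apply: measurable_funB => //; apply: measurableT_comp => //.
apply: continuous_measurable_rV => x.
exact: (differentiable_continuous (f_diff x)).
Qed.

Let square_slope (z : 'rV[R]_d * 'rV[R]_d) : \bar R :=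
  (dot (grad f z.1) z.2 ^+ 2)%:E.

Let measurable_square_slope : measurable_fun setT square_slope.
Proof.
apply/measurable_EFinP; apply: measurable_funX; apply: measurable_dot => i.
  exact: (measurableT_comp (measurable_grad i f_diff) measurable_fst).
exact: (measurableT_comp (measurable_coord i) measurable_snd).
Qed.

(** The one-step descent applies whenever |s_(t+1)| <= 1, and s_(t+1) has law [D], so the
    exceptional event is null. *)
Lemma stp_ae_descent t : {ae P, forall w,
  gap t.+1 w + slope t w ^+ 2 / (2 * L) <= gap t w + L / 8 * (h ^- t.+1) ^+ 2}.
Proof.
have [[_ law] _ _ _] := theta_STP.
set B := [set s : 'rV[R]_d | norm2 s <= 1].
have mB : measurable B := @measurable_ball2 R d.
exists (~` (s_ t.+1 @^-1` B)); split.
- by apply: measurableC; exact: measurable_funPTI.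
- rewrite probability_setC; last exact: measurable_funPTI.
  by rewrite [X in (_ - X)%E](law t.+1 isT B mB) D_bounded subee.
apply: subsetC => w /= sw.
have [_ amin] := stp_argmin t w.
have hpos : 0 < h ^- t.+1 by rewrite invr_gt0 exprn_gt0.
have := @stp_step_descent _ _ _ _ _ f_diff L_gt0 f_smooth mu_gt0 f_convex
  (h ^- t.+1) _ (f (theta t.+2 w)) (theta t.+1 w) (s_ t.+1 w) hpos sw erefl.
move=> /(_ (amin _ (or_introl (or_intror erefl))) (amin _ (or_intror erefl))).
by rewrite -/(slope t w) /gap; lra.
Qed.

Let A t : \bar R := (\int[P]_w (gap t w)%:E)%E.

Let mgap t : measurable_fun setT (fun w => (gap t w)%:E).
Proof. by apply/measurable_EFinP; exact: measurable_gap. Qed.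

Lemma stp_mean_gap_fin t : A t \is a fin_num.
Proof.
rewrite ge0_fin_numE; last first.
  by apply: integral_ge0 => w _; rewrite lee_fin stp_gap_ge0.
apply: (@le_lt_trans _ _ (\int[P]_w (f theta1 - f thetastar)%:E)%E).
  apply: ge0_le_integral => //.
  - by move=> w _; rewrite lee_fin stp_gap_ge0.
  - by move=> w _; rewrite lee_fin stp_gap_le.
by rewrite integral_cst// [X in (_ * X)%E]probability_setT mule1 ltry.
Qed.

(** With theta^(t+1) = x frozen, the integral over the draw is at least muD^2 |grad f x|^2, hence at
    least 2 mu muD^2 (f x - f thetastar). *)
Lemma stp_mean_square_slope t :
  ((2 * mu * muD ^+ 2)%:E * A t <= \int[P]_w (slope t w ^+ 2)%:E)%E.
Proof.
have [s_iid ruleP t1 rec] := theta_STP.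
have -> : (\int[P]_w (slope t w ^+ 2)%:E =
           \int[P]_w square_slope (theta t.+1 w, s_ t.+1 w))%E by [].
rewrite (integral_next s_iid (fun t t0 => (ruleP t t0).1) t1 rec)//; last first.
  by move=> z; rewrite lee_fin sqr_ge0.
rewrite -ge0_integralZl//; last 2 first.
- by move=> w _; rewrite lee_fin stp_gap_ge0.
- by rewrite lee_fin !mulr_ge0// ?sqr_ge0 ltW.
apply: ge0_le_integral => //.
- by move=> w _; rewrite -EFinM lee_fin !mulr_ge0// ?sqr_ge0 ?stp_gap_ge0// ltW.
- exact: emeasurable_funM.
- have sq0 z : (0 <= square_slope z)%E by rewrite lee_fin sqr_ge0.
  have mF := measurable_fun_fubini_tonelli_F (m2 := D) square_slope
    measurable_square_slope sq0.
  exact: (measurableT_comp mF (mtheta t)).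
move=> w _; set x := theta t.+1 w.
apply: (@le_trans _ _ (muD ^+ 2 * dot (grad f x) (grad f x))%:E).
  have pl := polyak_lojasiewicz mu_gt0 f_convex x thetastar.
  have := ler_wpM2l (sqr_ge0 muD) pl.
  by rewrite -EFinM lee_fin /gap -/x; lra.
exact: (mean_square_dot (ltW muD_gt0) D_dot).
Qed.

Lemma stp_mean_gap_rec t : fine (A t.+1) <=
  (1 - muD ^+ 2 * mu / L) * fine (A t) + L / 8 * (h ^- t.+1) ^+ 2.
Proof.
set c := L / 8 * (h ^- t.+1) ^+ 2.
have c0 : 0 <= c by rewrite mulr_ge0 ?sqr_ge0// divr_ge0// ltW.
have L20 : 0 <= (2 * L)^-1 by rewrite invr_ge0 mulr_ge0// ltW.
have mslope : measurable_fun setT (fun w => (slope t w ^+ 2)%:E).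
  have mpair := measurable_fun_pair (mtheta t)
    (@measurable_funP _ _ _ _ setT (s_ t.+1)).
  exact: (measurableT_comp measurable_square_slope mpair).
have : (A t.+1 + (2 * L)^-1%:E * \int[P]_w (slope t w ^+ 2)%:E <= A t + c%:E)%E.
  rewrite -ge0_integralZl//; last by move=> w _; rewrite lee_fin sqr_ge0.
  rewrite -ge0_integralD//; last 3 first.
  - by move=> w _; rewrite lee_fin stp_gap_ge0.
  - by move=> w _; rewrite -EFinM lee_fin mulr_ge0// sqr_ge0.
  - exact: emeasurable_funM.
  have -> : (A t + c%:E = \int[P]_w ((gap t w)%:E + c%:E))%E.
    rewrite ge0_integralD//; last by move=> w _; rewrite lee_fin stp_gap_ge0.
    by rewrite integral_cst// [X in (_ * X)%E]probability_setT mule1.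
  apply: ae_ge0_le_integral => //.
  - move=> w _; rewrite -EFinM -EFinD lee_fin addr_ge0 ?stp_gap_ge0//.
    by rewrite mulr_ge0// sqr_ge0.
  - by apply: emeasurable_funD => //; exact: emeasurable_funM.
  - by move=> w _; rewrite -EFinD lee_fin addr_ge0// stp_gap_ge0.
  - exact: emeasurable_funD.
  apply: filterS (stp_ae_descent t) => w + _.
  by rewrite -EFinM -!EFinD lee_fin mulrC.
have := lee_wpmul2l (_ : (0 <= ((2 * L)^-1)%:E)%E) (stp_mean_square_slope t).
rewrite lee_fin => /(_ L20).
rewrite -(fineK (stp_mean_gap_fin t)) -(fineK (stp_mean_gap_fin t.+1)).
set I := (\int[P]_w _)%E; set a := fine (A t); set b := fine (A t.+1).
move=> lo up.
(* The integral [I] is eliminated while still in the extended reals; what remains involves only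
   finite numbers. *)
have := le_trans (leeD2l b%:E lo) up.
rewrite -!EFinM -!EFinD lee_fin.
have -> : (2 * L)^-1 * (2 * mu * muD ^+ 2 * a) = muD ^+ 2 * mu / L * a.
  by field; rewrite gt_eqF.
by rewrite mulrBl mul1r addrAC lerBrDr.
Qed.

(** The mean gap is at most C q^t, so the ratio gap / r^t has mean at most C (q / r)^t, which is
    summable. *)
Lemma stp_ae_cvg r : h ^- 2 < 1 - muD ^+ 2 * mu / L ->
  1 - muD ^+ 2 * mu / L < r ->
  {ae P, forall w, (fun t => gap t w / r ^+ t) @ \oo --> (0 : R)}.
Proof.
set q := 1 - _ => kq qr.
have k0 : 0 <= h ^- 2 by rewrite invr_ge0 exprn_ge0// ltW.
have q0 : 0 < q by exact: le_lt_trans kq.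
have r0 : 0 < r by exact: lt_trans qr.
(* The error at shifted time t is (L / 8) h^(-2 (t + 1)): one factor h^(-2) goes into the
   constant. *)
pose c := L / 8 * h ^- 2.
have c0 : 0 <= c by rewrite mulr_ge0// divr_ge0// ltW.
have bound := @perturbed_geometric_bound _ (fine \o A) q c (h ^- 2) c0 k0 kq.
pose C := fine (A 0%N) + c / (q - h ^- 2).
have C0 : 0 <= C.
  rewrite addr_ge0//; last by rewrite divr_ge0// subr_ge0 ltW.
  by apply/fine_ge0/integral_ge0 => w _; rewrite lee_fin stp_gap_ge0.
apply: (@ae_cvg0_geometric _ _ _ _
  (fun t w => gap t w / r ^+ t) C (q / r)) => //.
- by rewrite divr_ge0// ltW.
- by rewrite ltr_pdivrMr// mul1r.
- by move=> n; apply: measurable_funM => //; exact: measurable_gap.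
- by move=> n w; rewrite divr_ge0 ?stp_gap_ge0// exprn_ge0// ltW.
move=> n.
under eq_integral => w _ do rewrite mulrC EFinM.
rewrite ge0_integralZl//; last 2 first.
- by move=> w _; rewrite lee_fin stp_gap_ge0.
- by rewrite lee_fin invr_ge0 exprn_ge0// ltW.
rewrite -/(A n) -(fineK (stp_mean_gap_fin n)) -EFinM lee_fin expr_div_n
  [leLHS]mulrC mulrA.
rewrite ler_wpM2r ?invr_ge0 ?exprn_ge0 ?(ltW r0)//.
apply: bound => t; apply: le_trans (stp_mean_gap_rec t) _.
rewrite lerD2l (_ : (h ^- t.+1) ^+ 2 = h ^- 2 * (h ^- 2) ^+ t) ?mulrA//.
by rewrite -exprS -[in RHS]exprVn -!exprVn -!exprM mulnC.
Qed.

End stp_convergence.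

(** * Little-o form of the rate and choice of [r] *)

Lemma littleo_pow_of_cvg0 (R : realType) (u : nat -> R) (r : R) : 0 < r ->
  (fun t => u t.+1 / r ^+ t) @ \oo --> (0 : R) -> u =o_\oo (fun t => r ^+ t).
Proof.
move=> r0 u0; apply/eqoP => e e0.
(* The shift of index between [u t.+1] and [r ^+ t] costs one factor [r], absorbed in the
   tolerance. *)
have er0 : 0 < e * r by rewrite mulr_gt0.
have [N _ NP] := cvgr0_norm_le _ u0 _ er0.
exists N.+1 => // -[//|t] /= Nt; have := NP t Nt.
rewrite /= normrM normfV !(gtr0_norm (exprn_gt0 _ r0)) ler_pdivrMr ?exprn_gt0//.
by rewrite exprS mulrA.
Qed.

Theorem theorem7 (R : realType) (d : nat)
  (f : 'rV[R]_d -> R) (L mu : R) (thetastar : 'rV[R]_d)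
  (f_diff : forall x, differentiable f x)
  (L_gt0 : 0 < L) (f_smooth : smooth L f)
  (mu_gt0 : 0 < mu) (f_convex : strongly_convex mu f)
  (f_min : unique_minimizer f thetastar)
  (D : probability 'rV[R]_d R) (muD : R)
  (D_moment2 : ('E_D[fun s => (norm2 s ^+ 2)%R] < +oo)%E)
  (muD_gt0 : 0 < muD)
  (D_dot : forall v : 'rV[R]_d,
    ('E_D[fun s => `|dot v s|%R] >= (muD * norm2 v)%:E)%E)
  (D_bounded : D [set s | norm2 s <= 1] = 1%E)
  (muD_lt1 : muD < 1)
  (h : R) (h_range : h \in `](Num.sqrt (1 - muD ^+ 2 * mu / L))^-1, +oo[)
  (dO : measure_display) (Omega : measurableType dO)
  (P : probability Omega R)
  (theta1 : 'rV[R]_d) (rule : nat -> 'rV[R]_d * 'rV[R]_d -> 'rV[R]_d)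
  (s_ : nat -> {RV P >-> 'rV[R]_d}) (theta : nat -> Omega -> 'rV[R]_d)
  (theta_STP : is_STP f D (stp_step f L h) theta1 rule s_ theta) :
  (forall s : R, s \in `]0, 1[ ->
    {ae P, forall w,
      (fun T : nat => f (theta T w) - f thetastar) =o_\oo
      (fun T : nat => (1 - s * (muD ^+ 2 * mu / L)) ^+ T)}) /\
  (forall K : R, 0 < K -> muD = K / Num.sqrt d%:R ->
    forall s : R, s \in `]0, 1[ ->
    {ae P, forall w,
      (fun T : nat => f (theta T w) - f thetastar) =o_\oo
      (fun T : nat => (1 - s * (mu * K ^+ 2 / (d%:R * L))) ^+ T)}).
Proof.
have ae_littleo s : s \in `]0, 1[ ->
    {ae P, forall w,
      (fun T : nat => f (theta T w) - f thetastar) =o_\oo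
      (fun T : nat => (1 - s * (muD ^+ 2 * mu / L)) ^+ T)}.
  rewrite in_itv/= => /andP[s0 s1].
  (* In dimension 0 the space is a single point and the gap is zero; in positive dimension a unit
     vector gives mu <= L. *)
  have [d0|d0] := posnP d.
    apply: aeW => w; apply/eqoP => e e0; apply: nearW => T.
    have -> : theta T w = thetastar.
      by apply/rowP => i; have := ltn_ord i; rewrite {2}d0.
    by rewrite subrr normr0 mulr_ge0// ltW.
  set rho := muD ^+ 2 * mu / L.
  have rho0 : 0 < rho by rewrite divr_gt0// mulr_gt0// exprn_gt0.
  have rho1 : rho < 1.
    rewrite ltr_pdivrMr// mul1r.
    apply: lt_le_trans
      (strong_convexity_le_smoothness f_diff L_gt0 f_smooth f_convex d0).
    by rewrite gtr_pMl// expr_lt1// ltW.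
  have srho : s * rho < rho by rewrite gtr_pMl.
  have q0 : 0 < 1 - rho by rewrite subr_gt0.
  have sq0 : 0 < Num.sqrt (1 - rho) by rewrite sqrtr_gt0.
  move: h_range; rewrite in_itv/= andbT => h_lb.
  have h0 : 0 < h by apply: lt_trans h_lb; rewrite invr_gt0.
  (* The range of [h] says that 1 / h lies below the square root of 1 - rho; squaring makes the
     finite-difference error decay faster than the contraction. *)
  have hq : h ^- 2 < 1 - rho.
    rewrite -(sqr_sqrtr (ltW q0)) -exprVn.
    rewrite ltr_pXn2r ?nnegrE ?invr_ge0 ?(ltW h0) ?(ltW sq0)//.
    by rewrite invf_plt.
  have r0 : 0 < 1 - s * rho by lra.
  (* Since s < 1, r = 1 - s rho is strictly above the mean rate 1 - rho, the room needed for
     summability. *)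
  have qr : 1 - rho < 1 - s * rho by lra.
  have := stp_ae_cvg f_diff L_gt0 f_smooth mu_gt0 f_convex f_min muD_gt0 D_dot
    D_bounded h0 theta_STP hq qr.
  apply: filterS => w; exact: littleo_pow_of_cvg0.
split=> // K K0 muDE s s01.
have -> : mu * K ^+ 2 / (d%:R * L) = muD ^+ 2 * mu / L.
  rewrite muDE expr_div_n sqr_sqrtr// invfM mulrA; congr (_ / _).
  by rewrite -mulrA mulrC.
exact: ae_littleo.
Qed.
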